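(* Let $K$ be a finite set with $|K|\ge2$ and $C,C_1,C_2,D$ nonempty countable sets. Let $u\in\Delta(K\times(C\times C_1\times C_2)\times D)$ and define $v=\mathrm{marg}_{K\times(C\times C_1)\times D}u$, $u'=\mathrm{marg}_{K\times(C\times C_2)\times D}u$, and $v'=\mathrm{marg}_{K\times C\times D}u$. Suppose that, under $u$, $c_1$ is conditionally independent from $(c,c_2,d)$ given $k$. Then $d(u',v')\ge d(u,v)$.
   Context: An information structure is a probability on triples (state $k\in K$, signal of player 1, signal of player 2) with countably many signals; player 1 is the maximizer, player 2 the minimizer. In $u,v,u',v'$ the signal of player 1 is respectively $(c,c_1,c_2)$, $(c,c_1)$, $(c,c_2)$, $c$, and that of player 2 is $d$. A payoff function is a map $g:K\times I\times J\to[-1,1]$ with $I,J$ finite nonempty sets; $\mathcal G$ is the set of all payoff functions. $\mathrm{val}(u,g)$ is the value of the zero-sum Bayesian game in which the state and signals are drawn from $u$, each player learns his own signal, they simultaneously choose $i\in I$, $j\in J$ (mixed actions depending on own signal allowed), and player 1 receives $g(k,i,j)$ from player 2. $d(u,v)=\sup_{g\in\mathcal G}|\mathrm{val}(u,g)-\mathrm{val}(v,g)|$. $\mathrm{marg}$ denotes marginal distributions. *)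

(* Defs.v *)
From HB Require Import structures.
From mathcomp Require Import all_boot all_order all_algebra.
From mathcomp Require Import all_classical all_reals all_analysis.

Set Implicit Arguments.
Unset Strict Implicit.
Unset Printing Implicit Defensive.

Import Order.TTheory GRing.Theory Num.Theory.

Local Open Scope classical_set_scope.
Local Open Scope ring_scope.

(* Delta(T), the probability mass functions on a countable T. *)
Record dist (R : realType) (T : countType) := Dist {
  pmf :> T -> R;
  pmf_ge0 : forall x, 0 <= pmf x;
  pmf_sum1 : \esum_(x in [set: T]) (pmf x)%:E = 1%E }.

(* The esum is at most 1, so [fine] loses nothing. *)
Definition Pr (R : realType) (T : countType) (u : dist R T) (A : set T) : R :=
  fine (\esum_(x in A) (u x)%:E).

Definition cPr (R : realType) (T : countType) (u : dist R T) (A B : set T) : R :=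
  Pr u (A `&` B) / Pr u B.

Lemma PrE (R : realType) (T : countType) (u : dist R T) (A : set T) :
  (Pr u A)%:E = \esum_(x in A) (u x)%:E.
Proof.
have u0 x : (0 <= (u x)%:E)%E by rewrite lee_fin pmf_ge0.
rewrite /Pr fineK// ge0_fin_numE; last by apply: esum_ge0.
apply: le_lt_trans (ltry (1 : R)).
rewrite -(pmf_sum1 u) esum_mkcond; apply: le_esum => x _.
by case: ifP.
Qed.

Section Image.
Variables (R : realType) (T S : countType) (f : T -> S) (u : dist R T).

Let image_pmf (y : S) : R := Pr u (f @^-1` [set y]).

Let image_pmf_ge0 y : 0 <= image_pmf y.
Proof.
rewrite -lee_fin PrE; apply: esum_ge0 => x _.
by rewrite lee_fin pmf_ge0.
Qed.

Let image_pmf_sum1 : \esum_(y in [set: S]) (image_pmf y)%:E = 1%E.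
Proof.
under eq_esum do rewrite PrE.
rewrite -(pmf_sum1 u) esum_esum; last by move=> *; rewrite lee_fin pmf_ge0.
apply: (@reindex_esum _ _ _ _ _ (fun x => (f x, x))
  (fun p => (u p.2)%:E)).
split=> [x _ //|x y _ _ [] //|[y x] /= [_ <-]]; by exists x.
Qed.

Definition image_dist : dist R S := Dist image_pmf_ge0 image_pmf_sum1.

End Image.

Definition cond_indep (R : realType) (T A B Z : countType) (u : dist R T)
    (X : T -> A) (Y : T -> B) (W : T -> Z) : Prop :=
  forall a b z, 0 < Pr u (W @^-1` [set z]) ->
    cPr u (X @^-1` [set a] `&` Y @^-1` [set b]) (W @^-1` [set z]) =
    cPr u (X @^-1` [set a]) (W @^-1` [set z]) *
    cPr u (Y @^-1` [set b]) (W @^-1` [set z]).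

(* Probabilities on triples (state, signal of player 1, signal of player 2). *)
Notation infostr R K C D := (dist R (K * C * D)%type).

Definition is_payoff (R : realType) (K I J : finType) (g : K -> I -> J -> R) :
  Prop := forall k i j, -1 <= g k i j <= 1.

Section Game.
Variables (R : realType) (K : finType) (C D : countType).
Variables (u : infostr R K C D) (I J : finType) (g : K -> I -> J -> R).

Definition strategy1 := C -> dist R I.
Definition strategy2 := D -> dist R J.

(* Probability that the state is k and the actions played are i and j; averaging g
   against this law on the finite set K x I x J is the expected payoff. *)
Definition play_law (s : strategy1) (t : strategy2) (k : K) (i : I) (j : J) : R :=
  fine (\esum_(cd in [set: C * D])
          (u (k, cd.1, cd.2) * s cd.1 i * t cd.2 j)%:E).

Definition payoff (s : strategy1) (t : strategy2) : R :=
  \sum_(k : K) \sum_(i : I) \sum_(j : J) play_law s t k i j * g k i j.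

Definition maxmin : R := sup [set inf [set payoff s t | t in setT] | s in setT].
Definition minmax : R := inf [set sup [set payoff s t | s in setT] | t in setT].

Definition is_value (x : R) : Prop := maxmin = x /\ minmax = x.

(* When I and J are nonempty and g is a payoff function the value exists by the
   minimax theorem, so the default 0 is irrelevant. *)
Definition game_value : R := xget 0 [set x | is_value x].

End Game.

Definition vdist (R : realType) (K : finType) (C D C' D' : countType)
    (u : infostr R K C D) (v : infostr R K C' D') : R :=
  sup [set r | exists (I J : finType) (g : K -> I -> J -> R),
    [/\ (0 < #|I|)%N, (0 < #|J|)%N, is_payoff g & r = `|game_value u g - game_value v g|]].

Section Projections.
Variables (K : finType) (C C1 C2 D : countType).
Implicit Type t : (K * (C * C1 * C2) * D)%type.

Definition state_of t : K := t.1.1.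
Definition c_of t : C := t.1.2.1.1.
Definition c1_of t : C1 := t.1.2.1.2.
Definition c2_of t : C2 := t.1.2.2.
Definition d_of t : D := t.2.

End Projections.

Section Marginals.
Variables (R : realType) (K : finType) (C C1 C2 D : countType).
Variable u : infostr R K (C * C1 * C2) D.

Definition marg_c_c1 : infostr R K (C * C1) D :=
  image_dist (fun t => (state_of t, (c_of t, c1_of t), d_of t)) u.

Definition marg_c_c2 : infostr R K (C * C2) D :=
  image_dist (fun t => (state_of t, (c_of t, c2_of t), d_of t)) u.

Definition marg_c : infostr R K C D :=
  image_dist (fun t => (state_of t, c_of t, d_of t)) u.

End Marginals.

(* Main.v *)
Require Import Defs.
From mathcomp Require Import all_boot all_order all_algebra.
From mathcomp Require Import all_classical all_reals all_analysis.
From mathcomp Require Import finmap ring lra.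

Set Implicit Arguments.
Unset Strict Implicit.
Unset Printing Implicit Defensive.

Import Order.TTheory GRing.Theory Num.Theory.

Local Open Scope classical_set_scope.
Local Open Scope ring_scope.

(** Knowing c1 lets player 1 choose a function from C1 to I instead of an action
in I.  Since c1 is independent of all other signals given k, nothing is lost by
replacing the signal by the choice of such a function, with a payoff averaged
over the law p(c1 | k): for every finite F included in C1, a game g with
action sets I and J is turned into a game g' with action sets I^F and J, such
that
<<
  g'(k, f, j) + 1 = sum over c1 in F of p(c1 | k) * (g(k, f(c1), j) + 1).
>>
A behavioural strategy of player 1 that observes c1 and a mixture of functions
F -> I are interchangeable: the product of the former over F is a law of
functions with the right marginals, and conversely the marginals of such a law
form a behavioural strategy ([lift_strategy], [unlift_strategy]).  Playing g in
a structure with c1 and playing g' in the structure without c1 therefore give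
the same payoff, up to the contribution of c1 outside F, which is at most
twice the tail of p.  The same g' serves the pair (u, u') and the pair (v, v'),
so that when the tail is small, |val(u', g') - val(v', g')| is close to
|val(u, g) - val(v, g)|, which proves the inequality between the distances.

This comparison controls the maxmin of the games ([lift_game_value]).  Passing
to their values requires the minimax theorem for Bayesian games with countably
many signals and finitely many actions ([game_valueE]).  It is obtained from
regret matching, run separately at each signal c of player 1 against nearly best
replies of player 2: after n rounds the regret at c is of order
sqrt(n) * P(c), so the time-average of the replies holds player 1 to the
maxmin up to a vanishing error.  No truncation or compactness of the strategy
sets is needed since the regrets are summable over c.

Payoffs are shifted by 1 throughout, to be nonnegative: all infinite sums are then
sums of nonnegative terms, which can be rearranged freely. *)

(** * Nonnegative infinite sums *)

Section Sums.
Variable R : realType.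

Lemma esum_fin (I : finType) (f : I -> \bar R) :
  (forall i, 0 <= f i)%E -> \esum_(i in [set: I]) f i = (\sum_i f i)%E.
Proof.
move=> f0; rewrite esum_fset//; last exact: finite_finset.
rewrite [RHS]fsbig_seq ?index_enum_uniq//; apply: eq_fsbigl.
by apply/seteqP; split=> // i _ /=; rewrite mem_index_enum.
Qed.

Lemma esumZ (T : choiceType) (A : set T) (a : R) (f : T -> \bar R) :
  0 <= a -> (forall x, 0 <= f x)%E ->
  \esum_(x in A) (a%:E * f x)%E = (a%:E * \esum_(x in A) f x)%E.
Proof.
have le (b : R) (h : T -> \bar R) : 0 <= b -> (forall x, 0 <= h x)%E ->
    (\esum_(x in A) (b%:E * h x)%E <= b%:E * \esum_(x in A) h x)%E.
  move=> b0 h0; apply: ge_ereal_sup => _ [X [finX XA] <-].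
  rewrite -ge0_mule_fsumr// lee_wpmul2l ?lee_fin//.
  by apply: ereal_sup_ubound; exists X.
rewrite le_eqVlt => /predU1P[<-|a0] f0.
  by rewrite mul0e esum1// => x _; rewrite mul0e.
apply/eqP; rewrite eq_le; apply/andP; split.
  by apply: le => //; exact: ltW.
have le1 : (\esum_(x in A) f x <=
    a^-1%:E * \esum_(x in A) (a%:E * f x)%E)%E.
  apply: le_trans (le _ _ _ _); last first.
  - by move=> x; apply: mule_ge0 => //; rewrite lee_fin ltW.
  - by rewrite invr_ge0 ltW.
  apply: le_esum => x Ax.
  by rewrite muleA -EFinM mulVf ?mul1e// lt0r_neq0.
have a0' : (0 <= a%:E)%E by rewrite lee_fin ltW.
have := lee_wpmul2l a0' le1.
by rewrite muleA -EFinM divff ?mul1e// lt0r_neq0.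
Qed.

Lemma esum_pair (T1 T2 : choiceType) (f : T1 * T2 -> \bar R) :
  (forall x, 0 <= f x)%E ->
  \esum_(x in [set: T1 * T2]) f x =
  \esum_(x in [set: T1]) \esum_(y in [set: T2]) f (x, y).
Proof.
move=> f0; rewrite esum_esum// (_ : _ `*`` _ = setT).
  by apply: eq_esum => -[].
by apply/seteqP; split=> // -[].
Qed.

Lemma esum_bij (T T' : choiceType) (e : T -> T') (f : T' -> \bar R) :
  bijective e ->
  \esum_(y in [set: T']) f y = \esum_(x in [set: T]) f (e x).
Proof. by move=> be; apply: reindex_esum; rewrite setTT_bijective. Qed.

(** Here x.1.2 is the signal of player 1, the rest of x being what he ignores. *)
Lemma esum_triple (K : finType) (C D : choiceType) (f : K * C * D -> \bar R) :
  (forall x, 0 <= f x)%E ->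
  \esum_(x in [set: K * C * D]) f x =
  \esum_(c in [set: C]) \esum_(kd in [set: K * D]) f (kd.1, c, kd.2).
Proof.
move=> f0; rewrite -(@esum_pair _ _ (fun z => f (z.2.1, z.1, z.2.2)))//.
apply: (@esum_bij _ _ (fun z : C * (K * D) => (z.2.1, z.1, z.2.2))).
by exists (fun x : K * C * D => (x.1.2, (x.1.1, x.2))) => [[c [k d]]|[[k c] d]].
Qed.

Lemma esum_state (K : finType) (C D : choiceType) (f : K * C * D -> \bar R) :
  (forall x, 0 <= f x)%E ->
  \esum_(x in [set: K * C * D]) f x =
  (\sum_k \esum_(cd in [set: C * D]) f (k, cd.1, cd.2))%E.
Proof.
move=> f0; rewrite -esum_fin; last by move=> k; apply: esum_ge0.
rewrite -(@esum_pair _ _ (fun z => f (z.1, z.2.1, z.2.2)))//.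
apply: (@esum_bij _ _ (fun z : K * (C * D) => (z.1, z.2.1, z.2.2))).
by exists (fun x : K * C * D => (x.1.1, (x.1.2, x.2))) => [[k [c d]]|[[k c] d]].
Qed.

Lemma esumZl_fin (T : choiceType) (a : R) (f : T -> R) :
  0 <= a -> (forall x, 0 <= f x) ->
  \esum_(x in [set: T]) (a * f x)%:E = (a%:E * \esum_(x in [set: T]) (f x)%:E)%E.
Proof. by move=> a0 f0; rewrite -esumZ// => x; rewrite lee_fin. Qed.

Lemma esum_sumr (T : choiceType) (I : finType) (f : T -> I -> R) :
  (forall x i, 0 <= f x i) ->
  \esum_(x in [set: T]) (\sum_i f x i)%:E =
  (\sum_i \esum_(x in [set: T]) (f x i)%:E)%E.
Proof.
move=> f0; rewrite -esum_sum; last by move=> *; rewrite lee_fin.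
by apply: eq_esum => x _; rewrite sumEFin.
Qed.

Lemma esum_le_fin (T : choiceType) (f : T -> \bar R) (M : R) :
  (forall x, 0 <= f x)%E -> (\esum_(x in [set: T]) f x <= M%:E)%E ->
  (\esum_(x in [set: T]) f x)%E \is a fin_num.
Proof.
move=> f0 fM; rewrite ge0_fin_numE; first exact: le_lt_trans fM (ltry _).
by apply: esum_ge0.
Qed.

Lemma esum_ge1 (T : choiceType) (f : T -> \bar R) x :
  (forall x, 0 <= f x)%E -> (f x <= \esum_(x in [set: T]) f x)%E.
Proof.
move=> f0; rewrite (esumID [set x])// setTI esum_set1// leeDl//.
exact: esum_ge0.
Qed.

End Sums.

(** Summability is what allows C1 to be replaced by a finite set. *)
Lemma esum_small_tail (R : realType) (T : choiceType) (f : T -> R) (d : R) :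
  (forall x, 0 <= f x) -> (\esum_(x in [set: T]) (f x)%:E)%E \is a fin_num ->
  0 < d ->
  exists F : {fset T}, (\esum_(x in ~` [set` F]) (f x)%:E <= d%:E)%E.
Proof.
move=> f0 fin d0; have fE0 x : (0 <= (f x)%:E)%E by rewrite lee_fin.
have [_ [X [finX _] <-] lt] := ub_ereal_sup_adherent d0 fin.
have /finite_fsetP[F XF] := finX; exists F; move: lt.
rewrite -esum_fset// XF -/(esum _ _) [X in (X - _ < _)%E](esumID [set` F])// !setTI.
rewrite lteBlDr// lteD2lE; first exact: ltW.
rewrite ge0_fin_numE ?esum_ge0//; apply: le_lt_trans (_ : _ <= \esum_(x in setT) (f x)%:E)%E _.
  by rewrite [leRHS](esumID [set` F])// setTI leeDl// esum_ge0.
by rewrite -ge0_fin_numE ?esum_ge0.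
Qed.

(** * Laws on finite sets and conditional probabilities *)

Lemma dist_ge0 (R : realType) (T : countType) (u : dist R T) x : 0 <= u x.
Proof. exact: Defs.pmf_ge0. Qed.
#[local] Hint Extern 0 (is_true (0 <= _)) => exact: dist_ge0 : core.

Section FiniteDist.
Variables (R : realType) (I : finType).

Lemma sum_dist (s : dist R I) : \sum_i s i = 1.
Proof.
apply: EFin_inj; rewrite -(pmf_sum1 s) esum_fin ?sumEFin// => i.
by rewrite lee_fin.
Qed.

Section Mk.
Variable f : I -> R.
Hypotheses (f0 : forall i, 0 <= f i) (f1 : \sum_i f i = 1).

Lemma fin_dist_sum1 : \esum_(i in [set: I]) (f i)%:E = 1%E.
Proof. by rewrite esum_fin ?sumEFin ?f1// => i; rewrite lee_fin. Qed.

Definition fin_dist : dist R I := Dist f0 fin_dist_sum1.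
End Mk.

Lemma exists_dist (f : I -> R) :
  (forall i, 0 <= f i) -> \sum_i f i = 1 -> exists s : dist R I, s =1 f.
Proof. by move=> f0 f1; exists (fin_dist f0 f1). Qed.

Lemma exists_dirac (i0 : I) : exists s : dist R I, forall i, s i = (i == i0)%:R.
Proof.
apply: exists_dist => [i|]; first exact: ler0n.
by rewrite (bigD1 i0)//= eqxx big1 ?addr0// => i /negbTE ->.
Qed.

End FiniteDist.

Section Conditioning.
Variables (R : realType) (T S : countType) (u : dist R T).

Lemma Pr_ge0 (A : set T) : 0 <= Pr u A.
Proof. by apply: fine_ge0; apply: esum_ge0 => x _; rewrite lee_fin. Qed.

Lemma Pr_set1 x : Pr u [set x] = u x.
Proof. by apply: EFin_inj; rewrite PrE esum_set1// lee_fin. Qed.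

Lemma le_Pr1 (A : set T) x : A x -> u x <= Pr u A.
Proof.
move=> Ax; rewrite -lee_fin PrE (esumID [set x]); last by move=> *; rewrite lee_fin.
rewrite setI1 mem_set// esum_set1 ?lee_fin//.
by rewrite leeDl// esum_ge0// => y _; rewrite lee_fin.
Qed.

Lemma image_distE (f : T -> S) y :
  (image_dist f u y)%:E = \esum_(x in f @^-1` [set y]) (u x)%:E.
Proof. exact: PrE. Qed.

Lemma esum_Pr_fibre (X : T -> S) (A : set T) :
  \esum_(y in [set: S]) (Pr u (X @^-1` [set y] `&` A))%:E = (Pr u A)%:E.
Proof.
under eq_esum do rewrite PrE.
rewrite PrE esum_esum; last by move=> *; rewrite lee_fin.
apply: (@reindex_esum _ _ _ _ _ (fun x => (X x, x)) (fun z => (u z.2)%:E)).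
split=> [x Ax //|x y _ _ [] //|[y x] /= [_ [<- Ax]]]; by exists x.
Qed.

Lemma cPr_ge0 (A B : set T) : 0 <= cPr u A B.
Proof. by rewrite divr_ge0// Pr_ge0. Qed.

Lemma esum_cPr_le1 (X : T -> S) (A : set T) :
  (\esum_(y in [set: S]) (cPr u (X @^-1` [set y]) A)%:E <= 1)%E.
Proof.
rewrite /cPr; under eq_esum do rewrite mulrC.
rewrite esumZl_fin ?invr_ge0 ?Pr_ge0//; last by move=> y; exact: Pr_ge0.
rewrite esum_Pr_fibre -EFinM lee_fin; have [->|A0] := eqVneq (Pr u A) 0.
  by rewrite mulr0.
by rewrite mulVf.
Qed.

End Conditioning.

(** * Payoffs as nonnegative sums *)

Section Payoff.
Variables (R : realType) (K : finType) (C D : countType) (u : infostr R K C D).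
Variables (I J : finType).
Implicit Types (s : strategy1 R C I) (t : strategy2 R D J) (h : K -> I -> J -> R).

(** The same number as [payoff] when h is nonnegative ([epayE]), but as a single
sum of nonnegative terms, and with values in the extended reals so that
no summability has to be carried along. *)
Definition epay h s t : \bar R :=
  \esum_(x in [set: K * C * D])
    (u x * \sum_i s x.1.2 i * \sum_j t x.2 j * h x.1.1 i j)%:E.

Lemma mix_ge0 h s t k c d : (forall k i j, 0 <= h k i j) ->
  0 <= \sum_i s c i * \sum_j t d j * h k i j.
Proof.
move=> h0; apply: sumr_ge0 => i _; apply: mulr_ge0 => //.
by apply: sumr_ge0 => j _; apply: mulr_ge0.
Qed.

Lemma epay_ge0 h s t : (forall k i j, 0 <= h k i j) -> (0 <= epay h s t)%E.
Proof. by move=> h0; apply: esum_ge0 => x _; rewrite lee_fin mulr_ge0// mix_ge0. Qed.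

Lemma play_lawE s t k i j :
  (play_law u s t k i j)%:E =
  \esum_(cd in [set: C * D]) (u (k, cd.1, cd.2) * s cd.1 i * t cd.2 j)%:E.
Proof.
have le1 (X : finType) (p : dist R X) x : p x <= 1.
  by rewrite -(sum_dist p) (bigD1 x)//= lerDl sumr_ge0.
rewrite /play_law fineK//; apply: (@esum_le_fin _ _ _ 1).
  by move=> cd; rewrite lee_fin !mulr_ge0.
rewrite -(Defs.pmf_sum1 u) esum_state; last by move=> x; rewrite lee_fin.
rewrite (bigD1 k)//= -[X in (X <= _)%E]adde0 leeD//; last first.
  by apply: sume_ge0 => k' _; apply: esum_ge0 => x _; rewrite lee_fin.
apply: le_esum => cd _; rewrite lee_fin -mulrA ler_piMr//.
by rewrite -[leRHS]mulr1 ler_pM.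
Qed.

Lemma epayE h s t : (forall k i j, 0 <= h k i j) ->
  (\sum_k \sum_i \sum_j play_law u s t k i j * h k i j)%:E = epay h s t.
Proof.
move=> h0; rewrite /epay esum_state; last first.
  by move=> x; rewrite lee_fin mulr_ge0 ?mix_ge0.
rewrite -sumEFin; apply: eq_bigr => k _ /=.
under eq_esum do rewrite mulr_sumr.
rewrite esum_sumr; last first.
  by move=> x i; rewrite !mulr_ge0// sumr_ge0// => j _; rewrite mulr_ge0.
rewrite -sumEFin; apply: eq_bigr => i _.
under eq_esum do rewrite mulrA mulr_sumr.
rewrite esum_sumr; last by move=> x j; rewrite !mulr_ge0.
rewrite -sumEFin; apply: eq_bigr => j _.
rewrite mulrC EFinM play_lawE -esumZl_fin//; last by move=> x; rewrite !mulr_ge0.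
by apply: eq_esum => x _; congr EFin; ring.
Qed.

Lemma epay1 s t : epay (fun _ _ _ => 1) s t = 1%E.
Proof.
rewrite -(Defs.pmf_sum1 u); apply: eq_esum => x _; congr EFin.
rewrite -[RHS]mulr1; congr *%R; rewrite -[RHS](sum_dist (s x.1.2)).
apply: eq_bigr => i _; rewrite -[RHS]mulr1; congr *%R.
by rewrite -[RHS](sum_dist (t x.2)); apply: eq_bigr => j _; rewrite mulr1.
Qed.

Lemma payoff_shift g s t : is_payoff g ->
  (payoff u g s t + 1)%:E = epay (fun k i j => g k i j + 1) s t.
Proof.
move=> gP; rewrite -epayE; last by move=> k i j; have := gP k i j; lra.
congr EFin; have one : 1 = \sum_k \sum_i \sum_j play_law u s t k i j * 1.
  by apply: EFin_inj; rewrite epayE// epay1.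
rewrite [X in _ + X]one /payoff -big_split; apply: eq_bigr => k _.
rewrite -big_split; apply: eq_bigr => i _.
by rewrite -big_split; apply: eq_bigr => j _; rewrite mulrDr.
Qed.

End Payoff.

(** * Maxmin and minmax of bounded functions *)

Section SupInf.
Variables (R : realType) (S T : Type) (s0 : S) (t0 : T) (P : S -> T -> R).
Hypothesis P_bound : forall s t, -1 <= P s t <= 1.

Lemma inf_row_le s t : inf [set P s t | t in setT] <= P s t.
Proof.
apply: ge_inf; last by exists t.
by exists (-1) => _ [t' _ <-]; case/andP: (P_bound s t').
Qed.

Lemma le_inf_row s x : (forall t, x <= P s t) -> x <= inf [set P s t | t in setT].
Proof.
move=> xP; apply: lb_le_inf; first by exists (P s t0), t0.
by move=> _ [t _ <-].
Qed.

Lemma inf_row_le_sup s :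
  inf [set P s t | t in setT] <= sup [set inf [set P s t | t in setT] | s in setT].
Proof.
apply: ub_le_sup; last by exists s.
exists 1 => _ [s' _ <-]; apply: le_trans (inf_row_le s' t0) _.
by case/andP: (P_bound s' t0).
Qed.

Lemma sup_inf_le x : (forall s, inf [set P s t | t in setT] <= x) ->
  sup [set inf [set P s t | t in setT] | s in setT] <= x.
Proof.
move=> Px; apply: ge_sup; first by exists (inf [set P s0 t | t in setT]), s0.
by move=> _ [s _ <-].
Qed.

Lemma sup_col_ge s t : P s t <= sup [set P s t | s in setT].
Proof.
apply: ub_le_sup; last by exists s.
by exists 1 => _ [s' _ <-]; case/andP: (P_bound s' t).
Qed.

Lemma inf_sup_le t x : (forall s, P s t <= x) ->
  inf [set sup [set P s t | s in setT] | t in setT] <= x.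
Proof.
move=> Px; apply: (@le_trans _ _ (sup [set P s t | s in setT])).
  apply: ge_inf; last by exists t.
  exists (-1) => _ [t' _ <-]; apply: le_trans (sup_col_ge s0 t').
  by case/andP: (P_bound s0 t').
by apply: ge_sup; [exists (P s0 t), s0|move=> _ [s _ <-]].
Qed.

Lemma sup_inf_le_inf_sup :
  sup [set inf [set P s t | t in setT] | s in setT] <=
  inf [set sup [set P s t | s in setT] | t in setT].
Proof.
apply: sup_inf_le => s; apply: lb_le_inf; first by exists (sup [set P s t0 | s in setT]), t0.
by move=> _ [t _ <-]; apply: le_trans (inf_row_le s t) (sup_col_ge s t).
Qed.

(** Nearly best replies are enough for the minimax theorem and, unlike best ones,
exist for every bounded function. *)
Lemma near_best_reply (e : R) : 0 < e -> exists br : S -> T,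
  forall s, P s (br s) <= sup [set inf [set P s t | t in setT] | s in setT] + e.
Proof.
move=> e0; suff /choice[br brP] : forall s, exists t,
    P s t <= sup [set inf [set P s t | t in setT] | s in setT] + e by exists br.
move=> s; have [|_ [t _ <-] le] := @inf_adherent _ [set P s t | t in setT] _ e0.
  split; first by exists (P s t0), t0.
  by exists (-1) => _ [t' _ <-]; case/andP: (P_bound s t').
by exists t; apply: le_trans (ltW le) _; rewrite lerD2r inf_row_le_sup.
Qed.

End SupInf.

Lemma sup_inf_comparison (R : realType) (S S' T : Type) (s0 : S) (t0 : T)
    (P : S -> T -> R) (P' : S' -> T -> R) (e : R) :
  (forall s t, -1 <= P s t <= 1) -> (forall s t, -1 <= P' s t <= 1) ->
  (forall s, exists s', forall t, P s t <= P' s' t + e) ->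
  sup [set inf [set P s t | t in setT] | s in setT] <=
  sup [set inf [set P' s t | t in setT] | s in setT] + e.
Proof.
move=> bP bP' PP'; apply: sup_inf_le => // s; have [s' le] := PP' s.
apply: le_trans (_ : inf [set P' s' t | t in setT] + e <= _); last first.
  by rewrite lerD2r inf_row_le_sup.
rewrite -lerBlDr; apply: le_inf_row => // t.
by rewrite lerBlDr; apply: le_trans (le t); apply: inf_row_le.
Qed.

(** * Regret matching *)

Section RegretMatching.
Variables (R : realType) (I : finType).

Definition pos_part (x : R) : R := Num.max x 0.

Lemma pos_part_ge0 x : 0 <= pos_part x.
Proof. by rewrite /pos_part le_max lexx orbT. Qed.

(** When no regret is positive the condition is void, and any law will do. *)
Lemma regret_matching (i0 : I) (q : I -> R) : exists s : dist R I,
  forall i, s i * \sum_l pos_part (q l) = pos_part (q i).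
Proof.
have S0 : 0 <= \sum_l pos_part (q l).
  by apply: sumr_ge0 => l _; exact: pos_part_ge0.
have [Sz|Snz] := eqVneq (\sum_l pos_part (q l)) 0.
  have [s _] := exists_dirac R i0; exists s => i; rewrite Sz mulr0; apply/esym.
  apply/eqP; have := Sz; move/eqP; rewrite psumr_eq0; last first.
    by move=> l _; exact: pos_part_ge0.
  by move/allP/(_ i); rewrite mem_index_enum => /(_ isT).
have [||s sE] := @exists_dist R I (fun i => pos_part (q i) / \sum_l pos_part (q l)).
- by move=> i; rewrite divr_ge0// pos_part_ge0.
- by rewrite -mulr_suml divff.
by exists s => i; rewrite sE divfK.
Qed.

(** Under regret matching the vector of positive regrets is orthogonal to the
increment of the regrets, so its squared norm grows by at most the
squared norm of the increment: linearly in time, instead of quadratically. *)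
Lemma regret_step (s : dist R I) (q w : I -> R) (b : R) :
  (forall i, s i * \sum_l pos_part (q l) = pos_part (q i)) ->
  (forall i, 0 <= w i <= b) ->
  \sum_i pos_part (q i + (w i - \sum_l s l * w l)) ^+ 2 <=
  \sum_i pos_part (q i) ^+ 2 + #|I|%:R * b ^+ 2.
Proof.
move=> sq wb; set m := \sum_l s l * w l.
have mb : 0 <= m <= b.
  rewrite sumr_ge0/=; last by move=> l _; rewrite mulr_ge0//; case/andP: (wb l).
  rewrite -[leRHS]mul1r -(sum_dist s) mulr_suml ler_sum// => l _.
  by rewrite ler_wpM2l//; case/andP: (wb l).
(* the regret-matching law is proportional to the positive regrets *)
have orth : \sum_i pos_part (q i) * (w i - m) = 0.
  under eq_bigr do rewrite mulrBr.
  rewrite sumrB -mulr_suml /m mulr_sumr; apply/eqP; rewrite subr_eq0; apply/eqP.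
  by apply: eq_bigr => i _; rewrite -sq; ring.
have step i : pos_part (q i + (w i - m)) ^+ 2 <=
    pos_part (q i) ^+ 2 + 2 * (pos_part (q i) * (w i - m)) + b ^+ 2.
  have /andP[w0 w1] := wb i; have /andP[m0 m1] := mb.
  have r2 : (w i - m) ^+ 2 <= b ^+ 2 by nra.
  rewrite /pos_part; case: (leP (q i) 0); case: (leP (q i + (w i - m)) 0) => * ; nra.
apply: le_trans (ler_sum _ (fun i _ => step i)) _.
by rewrite big_split/= big_split/= -mulr_sumr orth mulr0 addr0 sumr_const mulr_natl.
Qed.

End RegretMatching.

Section Minimax.
Variables (R : realType) (K : finType) (C D : countType) (u : infostr R K C D).
Variables (I J : finType).
Local Notation S := (strategy1 R C I).
Local Notation T := (strategy2 R D J).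

Definition signal_prob (c : C) : R :=
  fine (\esum_(kd in [set: K * D]) (u (kd.1, c, kd.2))%:E).

(** The payoff from playing i at c, weighted by the probability of c. *)
Definition action_payoff (h : K -> I -> J -> R) (t : T) (c : C) (i : I) : R :=
  fine (\esum_(kd in [set: K * D])
    (u (kd.1, c, kd.2) * \sum_j t kd.2 j * h kd.1 i j)%:E).

Lemma signal_probE c :
  (signal_prob c)%:E = \esum_(kd in [set: K * D]) (u (kd.1, c, kd.2))%:E.
Proof.
rewrite /signal_prob fineK//; apply: (@esum_le_fin _ _ _ 1).
  by move=> x; rewrite lee_fin.
rewrite -(Defs.pmf_sum1 u) esum_triple; last by move=> x; rewrite lee_fin.
apply: (@esum_ge1 _ _ (fun c => \esum_(kd in [set: K * D]) (u (kd.1, c, kd.2))%:E)).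
by move=> c'; apply: esum_ge0 => x _; rewrite lee_fin.
Qed.

Lemma signal_prob_sum1 : \esum_(c in [set: C]) (signal_prob c)%:E = 1%E.
Proof.
under eq_esum do rewrite signal_probE.
rewrite -(@esum_triple _ _ _ _ (fun x => (u x)%:E)) ?Defs.pmf_sum1// => x.
by rewrite lee_fin.
Qed.

Lemma signal_prob_ge0 c : 0 <= signal_prob c.
Proof. by apply: fine_ge0; apply: esum_ge0 => x _; rewrite lee_fin. Qed.

Variables (h : K -> I -> J -> R) (b : R).
Hypothesis b_ge0 : 0 <= b.
Hypothesis h_bound : forall k i j, 0 <= h k i j <= b.

Let h_ge0 k i j : 0 <= h k i j. Proof. by case/andP: (h_bound k i j). Qed.

Lemma reply_ge0 (t : T) k d i : 0 <= \sum_j t d j * h k i j.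
Proof. by apply: sumr_ge0 => j _; rewrite mulr_ge0. Qed.

Lemma reply_le (t : T) k d i : \sum_j t d j * h k i j <= b.
Proof.
rewrite -[leRHS]mul1r -(sum_dist (t d)) mulr_suml ler_sum// => j _.
by rewrite ler_wpM2l//; case/andP: (h_bound k i j).
Qed.

Lemma action_payoff_le_esum (t : T) c i :
  (\esum_(kd in [set: K * D])
    (u (kd.1, c, kd.2) * \sum_j t kd.2 j * h kd.1 i j)%:E <=
   (b * signal_prob c)%:E)%E.
Proof.
rewrite EFinM signal_probE -esumZl_fin//; apply: le_esum => x _.
by rewrite lee_fin mulrC ler_wpM2r// reply_le.
Qed.

Lemma action_payoffE (t : T) c i :
  (action_payoff h t c i)%:E = \esum_(kd in [set: K * D])
    (u (kd.1, c, kd.2) * \sum_j t kd.2 j * h kd.1 i j)%:E.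
Proof.
rewrite /action_payoff fineK//; apply: esum_le_fin (action_payoff_le_esum t c i).
by move=> x; rewrite lee_fin mulr_ge0// reply_ge0.
Qed.

(** The factor [signal_prob c] makes all later estimates summable over c. *)
Lemma action_payoff_bound (t : T) c i :
  0 <= action_payoff h t c i <= b * signal_prob c.
Proof.
rewrite -!lee_fin action_payoffE action_payoff_le_esum andbT.
by apply: esum_ge0 => x _; rewrite lee_fin mulr_ge0// reply_ge0.
Qed.

Lemma epay_by_signal (s : S) (t : T) :
  epay u h s t =
  \esum_(c in [set: C]) (\sum_i s c i * action_payoff h t c i)%:E.
Proof.
rewrite /epay esum_triple; last by move=> x; rewrite lee_fin mulr_ge0 ?mix_ge0.
apply: eq_esum => c _ /=.
under eq_esum do rewrite mulr_sumr.
rewrite esum_sumr; last by move=> x i; rewrite !mulr_ge0// reply_ge0.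
rewrite -sumEFin; apply: eq_bigr => i _.
rewrite EFinM action_payoffE -esumZl_fin//; last first.
  by move=> x; rewrite mulr_ge0// reply_ge0.
by apply: eq_esum => x _; congr EFin; ring.
Qed.

(** The payoff is affine in the strategy of player 2. *)
Lemma average_strategy (n : nat) (y : 'I_n.+1 -> T) : exists t : T,
  forall s : S, (n.+1%:R%:E * epay u h s t = \sum_m epay u h s (y m))%E.
Proof.
have n0 : n.+1%:R != 0 :> R by rewrite pnatr_eq0.
have /choice[t tE] : forall d, exists p : dist R J,
    p =1 fun j => (\sum_m y m d j) / n.+1%:R.
  move=> d; apply: exists_dist => [j|].
    by rewrite divr_ge0// sumr_ge0.
  rewrite -mulr_suml exchange_big/=.
  under eq_bigr do rewrite sum_dist.
  by rewrite sumr_const card_ord divff.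
exists t => s; rewrite -esumZl_fin//; last by move=> x; rewrite mulr_ge0 ?mix_ge0.
rewrite /epay -esum_sum; last by move=> x m _ _; rewrite lee_fin mulr_ge0 ?mix_ge0.
apply: eq_esum => x _; rewrite sumEFin; congr EFin.
rewrite -mulr_sumr mulrCA; congr (_ * _).
rewrite exchange_big mulr_sumr; apply: eq_bigr => i _ /=.
rewrite -mulr_sumr mulrCA; congr (_ * _).
rewrite exchange_big mulr_sumr; apply: eq_bigr => j _ /=.
by rewrite tE -mulr_suml mulrA mulrCA divff ?mulr1.
Qed.

(** The regrets at different signals do not interact, so regret matching can be run
at each of the countably many signals; the number of rounds
that brings the average regret at c below e * b * P(c) is the same for all c. *)
Lemma no_regret (i0 : I) (br : S -> T) (e : R) : 0 < e ->
  exists (n : nat) (s_ : nat -> S), forall c i,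
    \sum_(m < n.+1) action_payoff h (br (s_ m)) c i <=
    \sum_(m < n.+1) \sum_l s_ m c l * action_payoff h (br (s_ m)) c l +
    n.+1%:R * (e * (b * signal_prob c)).
Proof.
move=> e0.
have /choice[rm rmP] : forall q : I -> R, exists s : dist R I,
    forall i, s i * \sum_l pos_part (q l) = pos_part (q i).
  exact: regret_matching.
pose strat (Q : C -> I -> R) : S := fun c => rm (Q c).
pose gain Q c i := action_payoff h (br (strat Q)) c i -
  \sum_l strat Q c l * action_payoff h (br (strat Q)) c l.
pose Q_ := fix Q_ m := if m is m'.+1 then fun c i => Q_ m' c i + gain (Q_ m') c i
                       else (fun _ _ => 0 : R).
have QS m c : \sum_i pos_part (Q_ m c i) ^+ 2 <=
    m%:R * (#|I|%:R * (b * signal_prob c) ^+ 2).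
  elim: m => [|m IH].
    by rewrite mul0r big1// => i _; rewrite /= /pos_part maxxx expr0n.
  have := regret_step (rmP (Q_ m c)) (action_payoff_bound (br (strat (Q_ m))) c).
  move/le_trans; apply.
  by rewrite -natr1 mulrDl mul1r lerD2r.
have QE m c i : Q_ m c i = \sum_(l < m) gain (Q_ l) c i.
  by elim: m => [|m IH]; rewrite ?big_ord0// big_ord_recr/= -IH.
(* beyond this n, sqrt(n * #|I|) is smaller than n * e *)
have [n nP] : exists n, #|I|%:R / e ^+ 2 < n%:R :> R.
  exists (Num.bound (#|I|%:R / e ^+ 2)); apply: archi_boundP.
  by apply: divr_ge0; [exact: ler0n|exact: sqr_ge0].
exists n, (fun m => strat (Q_ m)) => c i.
rewrite -lerBlDl -sumrB -(QE n.+1).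
have := QS n.+1 c; set N : R := n.+1%:R; set B := b * signal_prob c => QB.
have B0 : 0 <= B by rewrite mulr_ge0// signal_prob_ge0.
have {QB}Q2 : pos_part (Q_ n.+1 c i) ^+ 2 <= N * (#|I|%:R * B ^+ 2).
  apply: le_trans QB; rewrite (bigD1 i)//= lerDl sumr_ge0// => l _.
  exact: sqr_ge0.
have nN : #|I|%:R <= N * e ^+ 2.
  rewrite -ler_pdivrMr ?exprn_gt0//; apply: le_trans (ltW nP) _.
  by rewrite ler_nat.
apply: (@le_trans _ _ (pos_part (Q_ n.+1 c i))); first by rewrite /pos_part le_max lexx.
have N0 : 0 <= N by rewrite ler0n.
rewrite -(@ler_pXn2r _ 2)// ?nnegrE ?pos_part_ge0//; last first.
  by rewrite mulr_ge0// mulr_ge0// ltW.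
apply: le_trans Q2 _; rewrite mulrA (_ : (N * (e * B)) ^+ 2 = N * (N * e ^+ 2) * B ^+ 2).
  by rewrite ler_wpM2r ?sqr_ge0// ler_wpM2l.
by ring.
Qed.

End Minimax.

(** * The minimax theorem *)

Section Value.
Variables (R : realType) (K : finType) (C D : countType) (u : infostr R K C D).
Variables (I J : finType).
Implicit Types (g : K -> I -> J -> R).

Lemma payoff_ge g s t : is_payoff g -> -1 <= payoff u g s t.
Proof.
move=> gP; rewrite -[leLHS]add0r lerBlDr -lee_fin payoff_shift//.
apply: epay_ge0 => k i j.
by have := gP k i j; lra.
Qed.

Lemma payoff_bound g s t : is_payoff g -> -1 <= payoff u g s t <= 1.
Proof.
move=> gP; rewrite payoff_ge//=.
have NgP : is_payoff (fun k i j => - g k i j).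
  by move=> k i j; have := gP k i j; lra.
have := payoff_ge s t NgP; rewrite lerNl; apply: le_trans.
suff <- : payoff u g s t = - payoff u (fun k i j => - g k i j) s t by [].
rewrite /payoff -sumrN; apply: eq_bigr => k _.
rewrite -sumrN; apply: eq_bigr => i _; rewrite -sumrN; apply: eq_bigr => j _.
by rewrite mulrN opprK.
Qed.

Variables (i0 : I) (j0 : J) (g : K -> I -> J -> R).
Hypothesis gP : is_payoff g.

Lemma exists_strategy1 : inhabited (strategy1 R C I).
Proof. by have [s _] := exists_dirac R i0; exists; exact: (fun=> s). Qed.

Lemma exists_strategy2 : inhabited (strategy2 R D J).
Proof. by have [t _] := exists_dirac R j0; exists; exact: (fun=> t). Qed.

(** Against the replies to a regret-matching sequence s_ m, a strategy of
player 1 does better on average than the s_ m themselves by at most the regret,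
which is below 2 e / 4 as the shifted payoffs lie in [0, 2].  The s_ m get at
most maxmin + e / 4 because the replies are nearly best.  Hence the average
reply holds player 1 to maxmin + 3 e / 4. *)
Lemma minmax_le_maxmin : minmax u g <= maxmin u g.
Proof.
have [s0] := exists_strategy1; have [t0] := exists_strategy2.
have bP s t := payoff_bound s t gP.
apply/ler_addgt0Pr => e e0.
have e4 : 0 < e / 4 by rewrite divr_gt0.
have [br brP] := near_best_reply t0 bP e4.
pose h k i j := g k i j + 1.
have hb k i j : 0 <= h k i j <= 2 by rewrite /h; have := gP k i j; lra.
have [n [s_ regret]] := no_regret u (ler0n _ 2) hb i0 br e4.
have [t tE] := average_strategy u hb (fun m : 'I_n.+1 => br (s_ m)).
apply: (inf_sup_le s0 bP (t := t)) => s.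
have n0 : 0 < n.+1%:R :> R by rewrite ltr0n.
set M := maxmin u g in brP *; rewrite -(ler_pM2l n0) -(lerD2r n.+1%:R).
rewrite -[X in _ + X <= _]mulr1 -mulrDr -lee_fin EFinM payoff_shift// tE.
under eq_bigr do rewrite (epay_by_signal _ (ler0n _ 2) hb).
rewrite -esum_sum; last first.
  move=> c m _ _; rewrite lee_fin sumr_ge0// => i _.
  by rewrite mulr_ge0//; case/andP: (action_payoff_bound u (ler0n _ 2) hb (br (s_ m)) c i).
apply: (@le_trans _ _ (\esum_(c in [set: C])
    (\sum_(m < n.+1) (\sum_l s_ m c l * action_payoff u h (br (s_ m)) c l)%:E
    + (n.+1%:R * (e / 4 * 2))%:E * (signal_prob u c)%:E))%E).
  apply: le_esum => c _; rewrite !sumEFin -EFinM -EFinD lee_fin exchange_big/=.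
  under eq_bigr do rewrite -mulr_sumr.
  apply: (le_trans (ler_sum _ (fun i _ => ler_wpM2l (dist_ge0 (s c) i) (regret c i)))).
  rewrite -mulr_suml sum_dist mul1r lerD2l.
  by rewrite !mulrA.
rewrite esumD; last 2 first.
- move=> c _; rewrite sume_ge0// => m _; rewrite lee_fin sumr_ge0// => i _.
  by rewrite mulr_ge0//; case/andP: (action_payoff_bound u (ler0n _ 2) hb (br (s_ m)) c i).
- move=> c _; rewrite -EFinM lee_fin !mulr_ge0 ?signal_prob_ge0//.
  by rewrite ltW.
rewrite esumZ; last 2 first.
- by rewrite !mulr_ge0// ltW.
- by move=> c; rewrite lee_fin signal_prob_ge0.
rewrite signal_prob_sum1 mule1 esum_sum; last first.
  move=> c m _ _; rewrite lee_fin sumr_ge0// => i _.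
  by rewrite mulr_ge0//; case/andP: (action_payoff_bound u (ler0n _ 2) hb (br (s_ m)) c i).
under eq_bigr do rewrite -(epay_by_signal _ (ler0n _ 2) hb) -payoff_shift//.
rewrite sumEFin -EFinD lee_fin.
have : \sum_(m < n.+1) (payoff u g (s_ m) (br (s_ m)) + 1) <=
    \sum_(m < n.+1) (M + e / 4 + 1).
  by apply: ler_sum => m _; rewrite lerD2r.
rewrite sumr_const card_ord -mulr_natl => le.
apply: le_trans (lerD le (lexx _)) _; nra.
Qed.

Lemma game_valueE : game_value u g = maxmin u g.
Proof.
have [s0] := exists_strategy1; have [t0] := exists_strategy2.
rewrite /game_value; case: xgetP => [x _ [-> //]|/(_ (maxmin u g)) []]; split=> //.
apply/eqP; rewrite eq_le minmax_le_maxmin/=.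
by apply: sup_inf_le_inf_sup => // s t; exact: payoff_bound.
Qed.

Lemma maxmin_bound : -1 <= maxmin u g <= 1.
Proof.
have [s0] := exists_strategy1; have [t0] := exists_strategy2.
have bP s t := payoff_bound s t gP; apply/andP; split.
  apply: le_trans (inf_row_le_sup t0 bP s0).
  by apply: le_inf_row => // t; exact: payoff_ge.
apply: (sup_inf_le s0) => s; apply: le_trans (inf_row_le bP s t0) _.
by case/andP: (bP s t0).
Qed.
End Value.

(** * Trading a conditionally independent signal for actions *)

Section Lift.
Variables (R : realType) (K : finType) (A B C1 D : countType).
Variables (w : infostr R K B D) (w' : infostr R K A D).
Variables (join : A -> C1 -> B) (split : B -> A * C1).
Hypotheses (joinK : forall a c, split (join a c) = (a, c))
           (splitK : forall b, join (split b).1 (split b).2 = b).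
Variable p : K -> C1 -> R.
Hypotheses (p_ge0 : forall k c, 0 <= p k c)
           (p_le1 : forall k, (\esum_(c in [set: C1]) (p k c)%:E <= 1)%E)
           (wE : forall k a c d, w (k, join a c, d) = w' (k, a, d) * p k c).
Variable F : {fset C1}.

Lemma esum_fset_sum (f : C1 -> R) : (forall c, 0 <= f c) ->
  \esum_(c in [set` F]) (f c)%:E = (\sum_(c : F) f (val c))%:E.
Proof.
move=> f0; rewrite esum_fset//; last by move=> c _; rewrite lee_fin.
by rewrite -fsbig_seq ?fset_uniq// big_seq_fsetE/= sumEFin.
Qed.

Variables (I J : finType).

(** Averaging g + 1 instead of g keeps the sum in [0, 2], hence the result in
[-1, 1], while giving the signals outside F a shifted payoff of 0: restricting
to F can only lower the payoff ([lift_payoff_le]). *)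
Definition lift_payoff (g : K -> I -> J -> R) (k : K) (f : {ffun F -> I}) (j : J) : R :=
  \sum_(c : F) p k (val c) * (g k (f c) j + 1) - 1.

Lemma lift_payoffP g : is_payoff g -> is_payoff (lift_payoff g).
Proof.
move=> gP k f j; rewrite /lift_payoff.
have p1 : \sum_(c : F) p k (val c) <= 1.
  rewrite -lee_fin -esum_fset_sum//; apply: le_trans (p_le1 k).
  rewrite [leRHS](esumID [set` F]) ?setTI//; last by move=> c _; rewrite lee_fin.
  by rewrite leeDl// esum_ge0// => c _; rewrite lee_fin.
have lo : 0 <= \sum_(c : F) p k (val c) * (g k (f c) j + 1).
  by apply: sumr_ge0 => c _; apply: mulr_ge0 => //; have := gP k (f c) j; lra.
have hi : \sum_(c : F) p k (val c) * (g k (f c) j + 1) <= (\sum_(c : F) p k (val c)) * 2.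
  rewrite mulr_suml; apply: ler_sum => c _; apply: ler_wpM2l => //.
  by have := gP k (f c) j; lra.
lra.
Qed.

(** The functions drawn by s' answer to c in F as the behavioural strategy s
does.  Only this marginal matters for payoffs, not the correlation between
answers to different c. *)
Definition responds_as (s' : strategy1 R A {ffun F -> I}) (s : strategy1 R B I) :=
  forall a (c : F) i, \sum_(f : {ffun F -> I} | f c == i) s' a f = s (join a (val c)) i.

(** The answers to different signals can be drawn independently. *)
Lemma lift_strategy (s : strategy1 R B I) : exists s', responds_as s' s.
Proof.
suff /choice[s' s'P] : forall a, exists q : dist R {ffun F -> I}, forall (c : F) i,
    \sum_(f : {ffun F -> I} | f c == i) q f = s (join a (val c)) i by exists s'.
move=> a; have [||q qE] := @exists_dist R {ffun F -> I}
    (fun f => \prod_(c : F) s (join a (val c)) (f c)).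
- by move=> f; apply: prodr_ge0.
- rewrite -(bigA_distr_bigA (fun c : F => s (join a (val c)))).
  by rewrite big1// => c _; exact: sum_dist.
exists q => c i; under eq_bigr do rewrite qE.
(* indicator of the event f c = i, as a factor of the product law *)
pose m c' l := if c' == c then (l == i)%:R else 1 : R.
transitivity (\sum_(f : {ffun F -> I})
    \prod_(c' : F) (s (join a (val c')) (f c') * m c' (f c'))).
  rewrite big_mkcond; apply: eq_bigr => f _; rewrite big_split/=.
  rewrite [X in _ * X](bigD1 c)//= /m eqxx [X in _ * (_ * X)]big1; last first.
    by move=> c' /negbTE ->.
  by case: eqP; rewrite mulr1 ?mulr1// mulr0.
rewrite -(bigA_distr_bigA (fun (c' : F) l => s (join a (val c')) l * m c' l)).
rewrite (bigD1 c)//= [X in _ * X]big1 ?mulr1.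
  rewrite (bigD1 i)//= /m !eqxx mulr1 big1 ?addr0// => l /negbTE ->.
  by rewrite mulr0.
move=> c' /negbTE cc'; rewrite -[RHS](sum_dist (s (join a (val c')))).
by apply: eq_bigr => l _; rewrite /m cc' mulr1.
Qed.

(** On F the strategy s plays the marginals of s', elsewhere the fixed action i0. *)
Lemma unlift_strategy (i0 : I) (s' : strategy1 R A {ffun F -> I}) :
  exists s, responds_as s' s.
Proof.
have /choice[s sP] : forall b, exists q : dist R I, forall c : F, (split b).2 = val c ->
    forall i, q i = \sum_(f : {ffun F -> I} | f c == i) s' (split b).1 f.
  move=> b; case: (boolP ((split b).2 \in F)) => bF; last first.
    have [q _] := exists_dirac R i0; exists q => c cE.
    by move: bF; rewrite cE (valP c).
  have [||q qE] := @exists_dist R I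
      (fun i => \sum_(f : {ffun F -> I} | f [` bF]%fset == i) s' (split b).1 f).
  - by move=> i; apply: sumr_ge0.
  - rewrite -[RHS](sum_dist (s' (split b).1)).
    by rewrite [RHS](partition_big (fun f : {ffun F -> I} => f [` bF]%fset) predT).
  exists q => c cE i; rewrite qE; have -> // : c = [` bF]%fset.
  by apply: val_inj => /=; rewrite cE.
by exists s => a c i; rewrite (sP _ c) joinK.
Qed.

Section Compare.
Variables (d : R) (d_ge0 : 0 <= d).
Hypothesis tail : forall k, (\esum_(c in ~` [set` F]) (p k c)%:E <= d%:E)%E.
Variables (g : K -> I -> J -> R) (gP : is_payoff g).
Let h k i j : R := g k i j + 1.
Let h' k f j : R := lift_payoff g k f j + 1.

Let h_bound k i j : 0 <= h k i j <= 2.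
Proof. by rewrite /h; have := gP k i j; lra. Qed.
Let h_ge0 k i j : 0 <= h k i j.
Proof. by case/andP: (h_bound k i j). Qed.

Let mix (s : strategy1 R B I) (t : strategy2 R D J) k a dd c :=
  \sum_i s (join a c) i * \sum_j t dd j * h k i j.

Let mixP s t k a dd c : 0 <= mix s t k a dd c.
Proof. exact: mix_ge0. Qed.

Let mix_le s t k a dd c : mix s t k a dd c <= 2.
Proof.
rewrite -[leRHS]mul1r -[X in _ <= X * _](sum_dist (s (join a c))) mulr_suml.
apply: ler_sum => i _.
by apply: ler_wpM2l => //; exact: (reply_le h_bound).
Qed.

Lemma epay_join s t : epay w h s t =
  \esum_(x in [set: K * A * D])
    ((w' x)%:E * \esum_(c in [set: C1]) (p x.1.1 c * mix s t x.1.1 x.1.2 x.2 c)%:E)%E.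
Proof.
rewrite /epay.
have bj : bijective (fun z : (K * A * D) * C1 => (z.1.1.1, join z.1.1.2 z.2, z.1.2)).
  exists (fun x : K * B * D => ((x.1.1, (split x.1.2).1, x.2), (split x.1.2).2)).
    by move=> [[[k a] dd] c]/=; rewrite joinK.
  by move=> [[k b] dd]/=; rewrite splitK.
rewrite (esum_bij _ bj) esum_pair; last first.
  by move=> x; rewrite lee_fin mulr_ge0// mix_ge0.
apply: eq_esum => -[[k a] dd] _ /=; rewrite -esumZl_fin//; last first.
  by move=> c; rewrite mulr_ge0.
by apply: eq_esum => c _; rewrite wE mulrA.
Qed.

(** Lifting amounts to discarding from the payoff of [epay_join] the signals c outside F. *)
Lemma epay_lift s s' t : responds_as s' s -> epay w' h' s' t =
  \esum_(x in [set: K * A * D])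
    ((w' x)%:E * \esum_(c in [set` F]) (p x.1.1 c * mix s t x.1.1 x.1.2 x.2 c)%:E)%E.
Proof.
move=> ss'; apply: eq_esum => -[[k a] dd] _ /=.
rewrite esum_fset_sum; last by move=> c; rewrite mulr_ge0.
rewrite -EFinM; congr (_ * _)%:E.
transitivity (\sum_f s' a f * \sum_(c : F) p k (val c) * \sum_j t dd j * h k (f c) j).
  apply: eq_bigr => f _; congr (_ * _).
  under [RHS]eq_bigr do rewrite mulr_sumr.
  rewrite exchange_big/=; apply: eq_bigr => j _.
  rewrite /h' /lift_payoff subrK mulr_sumr; apply: eq_bigr => c _.
  by rewrite mulrCA.
under eq_bigr do rewrite mulr_sumr.
rewrite exchange_big/=; apply: eq_bigr => c _.
under eq_bigr do rewrite mulrCA.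
rewrite -mulr_sumr; congr (_ * _).
rewrite (partition_big (fun f : {ffun F -> I} => f c) predT)//=.
apply: eq_bigr => i _; rewrite -ss' mulr_suml.
by apply: eq_bigr => f /eqP ->.
Qed.

Lemma lift_payoff_le s s' t : responds_as s' s ->
  payoff w' (lift_payoff g) s' t <= payoff w g s t.
Proof.
move=> ss'; rewrite -(lerD2r 1) -lee_fin !payoff_shift//; last exact: lift_payoffP.
rewrite (epay_lift _ ss') epay_join; apply: le_esum => x _.
apply: lee_wpmul2l; first by rewrite lee_fin.
rewrite [leRHS](esumID [set` F]) ?setTI//; last by move=> c _; rewrite lee_fin mulr_ge0.
by rewrite leeDl// esum_ge0// => c _; rewrite lee_fin mulr_ge0.
Qed.

(** The factor 2 bounds the shifted payoff. *)
Lemma le_lift_payoff s s' t : responds_as s' s ->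
  payoff w g s t <= payoff w' (lift_payoff g) s' t + 2 * d.
Proof.
move=> ss'; rewrite -(lerD2r 1) addrAC -lee_fin [leRHS]EFinD !payoff_shift//; last exact: lift_payoffP.
rewrite (epay_lift _ ss') epay_join.
have -> : (2 * d)%:E = \esum_(x in [set: K * A * D]) ((w' x)%:E * (2 * d)%:E)%E.
  under eq_esum do rewrite muleC.
  rewrite esumZ ?Defs.pmf_sum1 ?mule1//; first by rewrite mulr_ge0.
  by move=> x; rewrite lee_fin.
rewrite -esumD; last 2 first.
- move=> x _; apply: mule_ge0; first by rewrite lee_fin.
  by apply: esum_ge0 => c _; rewrite lee_fin mulr_ge0.
- by move=> x _; rewrite -EFinM lee_fin !mulr_ge0.
apply: le_esum => x _; rewrite -ge0_muleDr; last 2 first.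
- by apply: esum_ge0 => c _; rewrite lee_fin mulr_ge0.
- by rewrite lee_fin mulr_ge0.
apply: lee_wpmul2l; first by rewrite lee_fin.
rewrite [leLHS](esumID [set` F]) ?setTI//; last by move=> c _; rewrite lee_fin mulr_ge0.
rewrite leeD2l// EFinM.
apply: le_trans (lee_wpmul2l _ (tail x.1.1)); last by rewrite lee_fin.
rewrite -esumZ//; last by move=> c; rewrite lee_fin.
apply: le_esum => c _; rewrite -EFinM lee_fin mulrC.
by apply: ler_wpM2r.
Qed.

Lemma lift_game_value (i0 : I) (j0 : J) :
  `|game_value w g - game_value w' (lift_payoff g)| <= 2 * d.
Proof.
have g'P := lift_payoffP gP.
pose f0 : {ffun F -> I} := [ffun=> i0].
have [s0] := @exists_strategy1 R B I i0; have [s0'] := @exists_strategy1 R A _ f0.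
have [t0] := @exists_strategy2 R D J j0.
rewrite (game_valueE w i0 j0 gP) (game_valueE w' f0 j0 g'P) ler_distl.
apply/andP; split.
  rewrite lerBlDr; apply: (sup_inf_comparison s0' t0) => [s t|s t|s'].
  - exact: payoff_bound.
  - exact: payoff_bound.
  have [s ss'] := unlift_strategy i0 s'; exists s => t.
  apply: le_trans (lift_payoff_le t ss') _.
  by rewrite lerDl mulr_ge0.
apply: (sup_inf_comparison s0 t0) => [s t|s t|s].
- exact: payoff_bound.
- exact: payoff_bound.
by have [s' ss'] := lift_strategy s; exists s' => t; apply: le_lift_payoff.
Qed.

End Compare.
End Lift.

(** * Adding a signal that is independent given the state *)

Section Marginals.
Variables (R : realType) (K : finType) (C C1 C2 D : countType).
Variable u : dist R (K * (C * C1 * C2) * D)%type.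

Definition c1_law (k : K) (c1 : C1) : R :=
  cPr u (@c1_of K C C1 C2 D @^-1` [set c1]) (@state_of K C C1 C2 D @^-1` [set k]).

Hypothesis hci : cond_indep u (@c1_of K C C1 C2 D)
             (fun t => (c_of t, c2_of t, d_of t)) (@state_of K C C1 C2 D).

(** Conditional independence multiplied by the probability of k; when that
probability is 0, both sides vanish. *)
Lemma c1_factor k c c1 c2 d :
  u (k, (c, c1, c2), d) = marg_c_c2 u (k, (c, c2), d) * c1_law k c1.
Proof.
rewrite /c1_law; set Sk := @state_of K C C1 C2 D @^-1` [set k].
have [Pk|Pk] := eqVneq (Pr u Sk) 0.
  rewrite /cPr Pk invr0 !mulr0; apply/eqP; rewrite eq_le dist_ge0 andbT -Pk.
  exact: le_Pr1.
have Pk0 : 0 < Pr u Sk by rewrite lt_neqAle eq_sym Pk Pr_ge0.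
have := hci c1 (c, c2, d) Pk0; rewrite -/Sk {1 3}/cPr.
rewrite (_ : _ `&` _ `&` Sk = [set (k, (c, c1, c2), d)]); last first.
  apply/seteqP; split=> [[[k' [[c' c1'] c2']] d']|_ ->]//=.
  by rewrite /Sk /c1_of /c_of /c2_of /d_of /state_of/= => -[[-> [-> -> ->]] ->].
rewrite (_ : _ @^-1` [set (c, c2, d)] `&` Sk =
    (fun t => (state_of t, (c_of t, c2_of t), d_of t)) @^-1` [set (k, (c, c2), d)]);
    last first.
  apply/seteqP; split=> [[[k' [[c' c1'] c2']] d']|[[k' [[c' c1'] c2']] d']]/=.
    by rewrite /Sk /c_of /c2_of /d_of /state_of/= => -[[-> -> ->] ->].
  by rewrite /Sk /c_of /c2_of /d_of /state_of/= => -[-> -> -> ->].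
rewrite Pr_set1 => /(congr1 (fun x => x * Pr u Sk)).
by rewrite -[RHS]mulrA !divfK// mulrC.
Qed.

Lemma marg_c_c1E k c c1 d : (marg_c_c1 u (k, (c, c1), d))%:E =
  \esum_(c2 in [set: C2]) (u (k, (c, c1, c2), d))%:E.
Proof.
rewrite image_distE.
apply: (@reindex_esum _ _ _ _ _ (fun c2 => (k, (c, c1, c2), d)) (fun x => (u x)%:E)).
split=> [c2 _ //|c2 c2' _ _ [] //|[[k' [[c' c1'] c2']] d']]/=.
by rewrite /state_of /c_of /c1_of /c2_of /d_of/= => -[-> -> -> ->]; exists c2'.
Qed.

Lemma marg_c_c2E k c c2 d : (marg_c_c2 u (k, (c, c2), d))%:E =
  \esum_(c1 in [set: C1]) (u (k, (c, c1, c2), d))%:E.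
Proof.
rewrite image_distE.
apply: (@reindex_esum _ _ _ _ _ (fun c1 => (k, (c, c1, c2), d)) (fun x => (u x)%:E)).
split=> [c2' _ //|x y _ _ [] //|[[k' [[c' c1'] c2']] d']]/=.
by rewrite /state_of /c_of /c1_of /c2_of /d_of/= => -[-> -> -> ->]; exists c1'.
Qed.

Lemma marg_cE k c d : (marg_c u (k, c, d))%:E =
  \esum_(c2 in [set: C2]) (marg_c_c2 u (k, (c, c2), d))%:E.
Proof.
under eq_esum do rewrite marg_c_c2E.
rewrite image_distE -(@esum_pair _ _ _ (fun z => (u (k, (c, z.2, z.1), d))%:E)); last first.
  by move=> x; rewrite lee_fin.
apply: (@reindex_esum _ _ _ _ _ (fun z => (k, (c, z.2, z.1), d)) (fun x => (u x)%:E)).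
split=> [c2' _ //|[x1 x2] [y1 y2] _ _ /= [-> ->]//|[[k' [[c' c1'] c2']] d']]/=.
by rewrite /state_of /c_of /c1_of /c2_of /d_of/= => -[-> -> ->]; exists (c2', c1').
Qed.

Lemma c1_factor_marg k c c1 d :
  marg_c_c1 u (k, (c, c1), d) = marg_c u (k, c, d) * c1_law k c1.
Proof.
apply: EFin_inj; rewrite marg_c_c1E mulrC EFinM marg_cE -esumZl_fin ?cPr_ge0//.
by apply: eq_esum => c2 _; rewrite c1_factor mulrC.
Qed.

End Marginals.

Theorem proposition3 (R : realType) (K : finType) (C C1 C2 D : countType)
    (hK : (2 <= #|K|)%N)
    (hC : inhabited C) (hC1 : inhabited C1) (hC2 : inhabited C2)
    (hD : inhabited D)
    (u : dist R (K * (C * C1 * C2) * D)%type)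
    (v : dist R (K * (C * C1) * D)%type)
    (u' : dist R (K * (C * C2) * D)%type)
    (v' : dist R (K * C * D)%type)
    (hv : v = marg_c_c1 u) (hu' : u' = marg_c_c2 u) (hv' : v' = marg_c u)
    (hci : cond_indep u (@c1_of K C C1 C2 D)
             (fun t => (c_of t, c2_of t, d_of t)) (@state_of K C C1 C2 D)) :
  vdist u' v' >= vdist u v.
Proof.
rewrite {}hv {}hu' {}hv'; set p := c1_law u.
have p0 k c : 0 <= p k c by exact: cPr_ge0.
have p1 k : (\esum_(c in [set: C1]) (p k c)%:E <= 1)%E by exact: esum_cPr_le1.
apply/ler_addgt0Pr => e e0; have e4 : 0 < e / 4 by rewrite divr_gt0.
(* a tail of the sum over k dominates the tails of all the p k at once,
   so that one set F works for every state *)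
have pfin : (\esum_(c in [set: C1]) (\sum_k p k c)%:E)%E \is a fin_num.
  apply: (@esum_le_fin _ _ _ #|K|%:R) => [c|]; first by rewrite lee_fin sumr_ge0.
  rewrite esum_sumr//; apply: le_trans (lee_sum _ (fun k _ => p1 k)) _.
  by rewrite sumEFin sumr_const.
have [F Ftail] := esum_small_tail (fun c => sumr_ge0 _ (fun k _ => p0 k c)) pfin e4.
have tail k : (\esum_(c in ~` [set` F]) (p k c)%:E <= (e / 4)%:E)%E.
  apply: le_trans Ftail; apply: le_esum => c _.
  by rewrite lee_fin (bigD1 k)//= lerDl sumr_ge0.
rewrite {1}/vdist; apply: ge_sup.
  exists `|game_value u (fun _ (_ _ : unit) => 0) -
           game_value (marg_c_c1 u) (fun _ (_ _ : unit) => 0)|.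
  exists unit, unit, (fun _ _ _ => 0); rewrite card_unit; split=> //.
  by move=> k i j; rewrite lerN10 ler01.
move=> _ [I [J [g [I0 J0 gP ->]]]].
have [i0 _] := card_gt0P I0; have [j0 _] := card_gt0P J0.
pose g' : K -> {ffun F -> I} -> J -> R := lift_payoff p g.
have g'P : is_payoff g' := lift_payoffP p0 p1 gP.
have du : `|game_value u g - game_value (marg_c_c2 u) g'| <= 2 * (e / 4).
  apply: (lift_game_value (join := fun a c1 => (a.1, c1, a.2))
    (split := fun b => ((b.1.1, b.2), b.1.2))) => //.
  - by case.
  - by move=> [[]].
  - by move=> k a c1 d; rewrite c1_factor// -surjective_pairing.
  - exact: ltW.
have dv : `|game_value (marg_c_c1 u) g - game_value (marg_c u) g'|
    <= 2 * (e / 4).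
  apply: (lift_game_value (join := pair) (split := id)) => //.
  - by case.
  - by move=> k a c1 d; rewrite c1_factor_marg.
  - exact: ltW.
have : `|game_value (marg_c_c2 u) g' -
    game_value (marg_c u) g'| <= vdist (marg_c_c2 u) (marg_c u).
  apply: ub_le_sup.
    exists 2 => _ [I' [J' [f [I'0 J'0 fP ->]]]].
    have [i' _] := card_gt0P I'0; have [j' _] := card_gt0P J'0.
    rewrite (game_valueE _ i' j')// (game_valueE _ i' j')//.
    have := maxmin_bound (marg_c_c2 u) i' j' fP.
    have := maxmin_bound (marg_c u) i' j' fP.
    by move=> /andP[? ?] /andP[? ?]; rewrite ler_norml; lra.
  exists {ffun F -> I}, J, g'; split=> //.
  by apply/card_gt0P; exists [ffun=> i0].
move: du dv; rewrite !ler_norml => /andP[? ?] /andP[? ?] /andP[? ?].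
by apply/andP; split; lra.
Qed.
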